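(* The word $\mathbf{m}$ is the fixed point $\mathbf{m}=h_1(\mathbf{m})$, where $h_1$ is the morphism $h_1=[1000,1010]$ (i.e. $h_1(0)=1000$, $h_1(1)=1010$). The word $\boldsymbol{\ell}$ is the fixed point $\boldsymbol{\ell}=h_2(\boldsymbol{\ell})$, where $h_2$ is the morphism $h_2=[0001,0101]$ (i.e. $h_2(0)=0001$, $h_2(1)=0101$).
   Context: A factor of a word is a finite contiguous subword. A word $w$ encounters a pattern $p\in\{0,1\}^*$ if $g(p)$ is a factor of $w$ for some non-erasing morphism $g:\{0,1\}^*\to\{0,1\}^*$ (i.e. $g(0),g(1)$ non-empty). A (finite or one-sided infinite) binary word is good if it contains neither $11$ nor $1001$ as a factor, and encounters neither of the patterns $0000$ and $00010100$. For each non-negative integer $n$, $\ell_n$ (resp. $m_n$) is the lexicographically least (resp. greatest) binary word of length $n$, with $0<1$, that is a prefix of some one-sided infinite good word. For every $n$, $\ell_n$ is a prefix of $\ell_{n+1}$ and $m_n$ is a prefix of $m_{n+1}$; $\boldsymbol{\ell}=\lim_{n\to\infty}\ell_n$ and $\mathbf{m}=\lim_{n\to\infty}m_n$ are the one-sided infinite words having all $\ell_n$ (resp. all $m_n$) as prefixes. Morphisms are extended letterwise to infinite words. *)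

(* Defs.v *)
From HB Require Import structures.
From mathcomp Require Import all_boot all_order.

Set Implicit Arguments.
Unset Strict Implicit.
Unset Printing Implicit Defensive.

(* The binary alphabet is bool, with 0 = false and 1 = true (so that 0 < 1 in
   the order of bool).  Finite words have type seq bool and one-sided infinite
   words have type nat -> bool, indexed from 0. *)
Definition bits (s : seq nat) : seq bool := [seq d == 1 | d <- s].

Definition prefix_of (w : nat -> bool) (n : nat) : seq bool := mkseq w n.

Definition factor (u : seq bool) (w : nat -> bool) : Prop :=
  exists i, u = mkseq (fun j => w (i + j)) (size u).

(* A morphism of {0,1}^* is given by its images of the two letters. *)
Definition mor (u0 u1 : seq bool) : bool -> seq bool :=
  fun c => if c then u1 else u0.

Definition apply_mor (g : bool -> seq bool) (p : seq bool) : seq bool :=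
  flatten (map g p).

Definition nonerasing (g : bool -> seq bool) : Prop := forall c, g c != [::].

(* For a non-erasing g, the image of the prefix of length i.+1 has length
   greater than i, so the default value of nth is never used, and this is the
   infinite word g (w 0) g (w 1) g (w 2) ... *)
Definition apply_mor_inf (g : bool -> seq bool) (w : nat -> bool) : nat -> bool :=
  fun i => nth false (apply_mor g (prefix_of w i.+1)) i.

Definition encounters (w : nat -> bool) (p : seq bool) : Prop :=
  exists g, nonerasing g /\ factor (apply_mor g p) w.

Definition good (w : nat -> bool) : Prop :=
  [/\ ~ factor (bits [:: 1; 1]) w,
      ~ factor (bits [:: 1; 0; 0; 1]) w,
      ~ encounters w (bits [:: 0; 0; 0; 0]) &
      ~ encounters w (bits [:: 0; 0; 0; 1; 0; 1; 0; 0])].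

Definition good_prefix (n : nat) (u : seq bool) : Prop :=
  exists w, good w /\ u = prefix_of w n.

Definition lex_le (u v : seq bool) : bool :=
  (u <= v :> seqlexi bool)%O.

Definition is_ell_n (n : nat) (u : seq bool) : Prop :=
  good_prefix n u /\ forall v, good_prefix n v -> lex_le u v.

Definition is_m_n (n : nat) (u : seq bool) : Prop :=
  good_prefix n u /\ forall v, good_prefix n v -> lex_le v u.

Definition is_ell (l : nat -> bool) : Prop := forall n, is_ell_n n (prefix_of l n).

Definition is_m (m : nat -> bool) : Prop := forall n, is_m_n n (prefix_of m n).

Definition fixed_point (h : bool -> seq bool) (w : nat -> bool) : Prop :=
  w =1 apply_mor_inf h w.

Definition the_fixed_point (h : bool -> seq bool) (w : nat -> bool) : Prop :=
  fixed_point h w /\ forall w', fixed_point h w' -> w' =1 w.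

Definition h1 : bool -> seq bool := mor (bits [:: 1; 0; 0; 0]) (bits [:: 1; 0; 1; 0]).

Definition h2 : bool -> seq bool := mor (bits [:: 0; 0; 0; 1]) (bits [:: 0; 1; 0; 1]).

(* Main.v *)
Require Import Defs.
From mathcomp Require Import all_boot all_order zify.

(* Let pd = [01,00] be the period-doubling morphism and pd' = [10,00] its
   conjugate.  In a good word consecutive 1s are at distance 2 or 4, so all 1s lie at
   positions of one parity and the word is pd(v) or pd'(v); as pd(11) = 0000 and
   pd(1001) = 00010100, the word v is good as well (for pd', provided v starts
   with 0).  Both morphisms reverse the lexicographic order, whence by a simultaneous
   induction on the first difference the extremal words are the ones with
   l = pd(m) and m = pd'(l), so that m = pd'(pd(m)) = h1(m) and
   l = pd(pd'(l)) = h2(l).  These two words are themselves good because an occurrence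
   of a forbidden pattern in pd(v) desubstitutes to a shorter one in v. *)

Set Implicit Arguments.
Unset Strict Implicit.
Unset Printing Implicit Defensive.

Import Order.TTheory.

(** * Occurrences of factors, and their images under uniform morphisms *)

Definition occurs_at (w : nat -> bool) (i : nat) (u : seq bool) : Prop :=
  forall j, j < size u -> nth false u j = w (i + j).

Lemma factorP u w : factor u w <-> exists i, occurs_at w i u.
Proof.
split=> -[i Hi]; exists i.
  by move=> j hj; rewrite {1}Hi nth_mkseq.
apply: (@eq_from_nth _ false); rewrite ?size_mkseq // => j hj.
by rewrite nth_mkseq // Hi.
Qed.

Lemma occurs_at_cat w i u v :
  occurs_at w i (u ++ v) <-> occurs_at w i u /\ occurs_at w (i + size u) v.
Proof.
split=> [H|[Hu Hv] j].
  split=> j hj.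
    by rewrite -H ?size_cat ?ltn_addr // nth_cat hj.
  by rewrite -addnA -H ?size_cat ?ltn_add2l // nth_cat ltnNge leq_addr addKn.
rewrite size_cat nth_cat => hj; case: ltnP => hu; first exact: Hu.
by rewrite Hv; [congr (w _); lia | lia].
Qed.

Lemma occurs_at_cons w i c u :
  occurs_at w i (c :: u) <-> w i = c /\ occurs_at w i.+1 u.
Proof.
split=> [H|[Hc Hu] [|j] hj /=]; last 2 first.
- by rewrite addn0.
- by rewrite Hu // addSnnS.
split; first by have := H 0 isT; rewrite addn0.
by move=> j hj; rewrite addSnnS -H.
Qed.

Lemma occurs_at_mor v w h n :
  (forall c, size (h c) = n) -> (forall i, occurs_at w (n * i) (h (v i))) ->
  forall u i, occurs_at v i u -> occurs_at w (n * i) (apply_mor h u).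
Proof.
move=> sh Hw; elim=> [|c u IH] i // /occurs_at_cons[<- Hu].
by apply/occurs_at_cat; split=> //; rewrite sh -mulnSr; apply: IH.
Qed.

Lemma apply_mor_comp h g p :
  apply_mor h (apply_mor g p) = apply_mor (fun c => apply_mor h (g c)) p.
Proof.
elim: p => //= c p IH.
by rewrite /apply_mor /= map_cat flatten_cat; congr (_ ++ _).
Qed.

(** Composing the morphism found in [v] with [h] gives one for [w]. *)
Lemma encounters_mor v w h n p :
  0 < n -> (forall c, size (h c) = n) ->
  (forall i, occurs_at w (n * i) (h (v i))) -> encounters v p -> encounters w p.
Proof.
move=> n0 sh Hw [g [neg /factorP[i Hi]]].
exists (fun c => apply_mor h (g c)); split.
  move=> c; have := neg c; case: (g c) => //= b s _.
  by rewrite -size_eq0 size_cat sh; lia.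
by apply/factorP; exists (n * i); rewrite -apply_mor_comp; apply: occurs_at_mor.
Qed.

Lemma encounters_factor w p i : occurs_at w i p -> encounters w p.
Proof.
exists (fun c => [:: c]); split=> //; apply/factorP; exists i.
suff -> : apply_mor (fun c => [:: c]) p = p by [].
by elim: {H} p => //= c p; rewrite /apply_mor /= => ->.
Qed.

(** * Positions of the 1s in a good word *)

Definition same_parity (w : nat -> bool) : Prop :=
  forall i j, w i -> w j -> odd i = odd j.

Lemma good_no11 w i : good w -> w i -> w i.+1 = false.
Proof.
move=> [H _ _ _] wi; apply/negP => wi1; apply: H; apply/factorP; exists i.
by do 2!(apply/occurs_at_cons; split=> //).
Qed.

Lemma good_no1001 w i : good w -> w i -> w i.+1 = false -> w i.+2 = false -> w i.+3 = false.
Proof.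
move=> [_ H _ _] w0 w1 w2; apply/negP => w3; apply: H; apply/factorP; exists i.
by do 4!(apply/occurs_at_cons; split=> //).
Qed.

Lemma good_no0000 w i : good w ->
  w i = false -> w i.+1 = false -> w i.+2 = false -> w i.+3.
Proof.
move=> [_ _ H _] w0 w1 w2; apply: contraT => /negbTE w3; case: H.
by apply: (@encounters_factor _ _ i); do 4!(apply/occurs_at_cons; split=> //).
Qed.

(** Induction on the gap: excluding 11, 1001 and 0000 puts the next 1 at distance 2 or 4, which
    leaves a smaller odd gap, down to the impossible gaps 1 and 3. *)
Lemma good_odd_gap w i k : good w -> w i -> w (i + k.*2.+1) = false.
Proof.
move=> Hw; elim/ltn_ind: k i => -[|k] IH i wi.
  by rewrite addn1; apply: good_no11.
case E2: (w i.+2).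
  have -> : i + (k.+1).*2.+1 = i.+2 + k.*2.+1 by lia.
  exact: IH.
have E1 := good_no11 Hw wi; have E3 := good_no1001 Hw wi E1 E2.
case: k IH => [|k] IH; first by rewrite -E3; congr (w _); lia.
have -> : i + (k.+2).*2.+1 = i.+4 + k.*2.+1 by lia.
by apply: IH; [lia | apply: good_no0000].
Qed.

Lemma good_same_parity w : good w -> same_parity w.
Proof.
move=> Hw; suff H i j : i <= j -> w i -> w j -> odd i = odd j.
  move=> i j wi wj; case: (leqP i j) => [|/ltnW] ij; first exact: H.
  by apply/esym/H.
move=> ij wi wj; case: (boolP (odd i == odd j)) => [/eqP //|ne].
have := good_odd_gap (j - i)./2 Hw wi.
have -> : i + ((j - i)./2).*2.+1 = j by lia.
by rewrite wj.
Qed.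

(** * Desubstitution of good words *)

Definition pd : bool -> seq bool := mor (bits [:: 0; 1]) (bits [:: 0; 0]).
Definition pd' : bool -> seq bool := mor (bits [:: 1; 0]) (bits [:: 0; 0]).

Definition is_pd (v w : nat -> bool) : Prop :=
  forall i, w i.*2 = false /\ w i.*2.+1 = ~~ v i.
Definition is_pd' (v w : nat -> bool) : Prop :=
  forall i, w i.*2 = ~~ v i /\ w i.*2.+1 = false.

Lemma is_pd_occurs v w : is_pd v w -> forall i, occurs_at w (2 * i) (pd (v i)).
Proof.
move=> H i; have [H0 H1] := H i; rewrite mul2n.
by case E: (v i) H0 H1 => /= H0 H1; do 2!(apply/occurs_at_cons; split=> //).
Qed.

Lemma is_pd'_occurs v w : is_pd' v w -> forall i, occurs_at w (2 * i) (pd' (v i)).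
Proof.
move=> H i; have [H0 H1] := H i; rewrite mul2n.
by case E: (v i) H0 H1 => /= H0 H1; do 2!(apply/occurs_at_cons; split=> //).
Qed.

Lemma good_of_pd v w : is_pd v w -> good w -> good v.
Proof.
move=> H Hw; have Hocc := occurs_at_mor (_ : forall c, size (pd c) = 2) (is_pd_occurs H).
have s2 : forall c, size (pd c) = 2 by case.
have [_ _ H3 H4] := Hw; split.
- move=> /factorP[i /(Hocc s2) Hi]; apply: H3; exact: encounters_factor Hi.
- move=> /factorP[i /(Hocc s2) Hi]; apply: H4; exact: encounters_factor Hi.
- by move=> Hv; apply: H3; apply: (encounters_mor _ s2 (is_pd_occurs H) Hv).
- by move=> Hv; apply: H4; apply: (encounters_mor _ s2 (is_pd_occurs H) Hv).
Qed.

(* Since [0 pd'(c) = pd(c) 0], a non-initial occurrence of 1001 in [v] still yields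
   pd(1001) = 00010100 in [w]; the hypothesis on [v 0] excludes an initial one. *)
Lemma good_of_pd' v w : is_pd' v w -> v 0 = false -> good w -> good v.
Proof.
move=> H v0 Hw; have Hocc := occurs_at_mor (_ : forall c, size (pd' c) = 2) (is_pd'_occurs H).
have s2 : forall c, size (pd' c) = 2 by case.
have [_ _ H3 H4] := Hw; split.
- move=> /factorP[i /(Hocc s2) Hi]; apply: H3; exact: encounters_factor Hi.
- move=> /factorP[[|i]] Hi; first by move/occurs_at_cons: Hi => []; rewrite v0.
  apply: H4; apply: (@encounters_factor _ _ (i.*2.+1)).
  apply/occurs_at_cons; split; first by have [] := H i.
  have := Hocc s2 _ _ Hi; have -> : 2 * i.+1 = i.*2.+2 by lia.
  rewrite -[apply_mor _ _]/(bits [:: 0; 0; 1; 0; 1; 0; 0] ++ bits [:: 0]).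
  by move=> /occurs_at_cat[].
- by move=> Hv; apply: H3; apply: (encounters_mor _ s2 (is_pd'_occurs H) Hv).
- by move=> Hv; apply: H4; apply: (encounters_mor _ s2 (is_pd'_occurs H) Hv).
Qed.

Lemma good_is_pd w i : good w -> odd i -> w i ->
  is_pd (fun k => ~~ w k.*2.+1) w.
Proof.
move=> Hw oi wi k; rewrite negbK; split=> //; apply/negP => wk.
by have := good_same_parity Hw wi wk; rewrite oi odd_double.
Qed.

Lemma good_is_pd' w i : good w -> ~~ odd i -> w i ->
  is_pd' (fun k => ~~ w k.*2) w.
Proof.
move=> Hw /negbTE oi wi k; rewrite negbK; split=> //; apply/negP => wk.
by have := good_same_parity Hw wi wk; rewrite oi /= odd_double.
Qed.

(** * The two extremal words, defined by mutual recursion *)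

(* For [b = true] this is the word m, for [b = false] the word l. *)
Fixpoint period_doubling_rec (fuel : nat) (b : bool) (n : nat) : bool :=
  if fuel is f.+1 then
    if odd n == b then false else ~~ period_doubling_rec f (~~ b) n./2
  else false.

(** Positive indices are halved, and index 0 is visited at most twice, since [b = false] stops
    there; hence [n.+2] units of fuel suffice. *)
Definition period_doubling (b : bool) (n : nat) : bool := period_doubling_rec n.+2 b n.

Lemma period_doubling_recS f b n : period_doubling_rec f.+1 b n =
  if odd n == b then false else ~~ period_doubling_rec f (~~ b) n./2.
Proof. by []. Qed.

Lemma period_doubling_rec_fuel f b n :
  n.+1 < f -> period_doubling_rec f b n = period_doubling b n.
Proof.
elim/ltn_ind: n f b => n IH f b hf; rewrite /period_doubling.
case: f hf => // f hf; case: n IH hf => [|n] IH hf.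
  by case: f hf => // f _; case: b.
rewrite [LHS]period_doubling_recS [RHS]period_doubling_recS; case: ifP => // _.
by congr (~~ _); transitivity (period_doubling (~~ b) n.+1./2); [|symmetry]; apply: IH; lia.
Qed.

Lemma period_doublingE b n :
  period_doubling b n = if odd n == b then false else ~~ period_doubling (~~ b) n./2.
Proof.
rewrite -(@period_doubling_rec_fuel n.+3) //=; case: ifP => // _; congr (~~ _).
by rewrite -(@period_doubling_rec_fuel n.+2) //; lia.
Qed.

Notation word_m := (period_doubling true).
Notation word_l := (period_doubling false).

Lemma word_l_pd : is_pd word_m word_l.
Proof.
move=> i; rewrite period_doublingE odd_double; split=> //.
by rewrite period_doublingE /= odd_double /= uphalf_double.
Qed.

Lemma word_m_pd' : is_pd' word_l word_m.
Proof.
move=> i; rewrite period_doublingE odd_double doubleK; split=> //.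
by rewrite period_doublingE /= odd_double.
Qed.

Lemma word_parity b i : period_doubling b i -> odd i = ~~ b.
Proof. by rewrite period_doublingE; case: (odd i); case: b. Qed.

Lemma word_same_parity b : same_parity (period_doubling b).
Proof. by move=> i j /word_parity-> /word_parity->. Qed.

(** * Desubstitution of pattern occurrences, and goodness of the two words *)

Lemma is_pd_even v u n : is_pd v u -> ~~ odd n -> u n = false.
Proof. by move=> /(_ n./2)[H _] en; rewrite -(even_halfK en). Qed.

Lemma same_parity_no11 v i : same_parity v -> v i -> v i.+1 -> False.
Proof. by move=> H vi vi1; have := H _ _ vi vi1 => /=; case: (odd i). Qed.

(** Four consecutive positions include two successive odd ones, where zeros of [u] come from
    adjacent 1s of [v]. *)
Lemma is_pd_no0000 v u i : same_parity v -> is_pd v u ->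
  (forall n, i <= n < i + 4 -> u n = false) -> False.
Proof.
move=> Hv Hu H.
have [_ E1] := Hu i./2; have [_ E2] := Hu i./2.+1.
move: E1 E2; rewrite !H; try lia.
by move=> /esym/negbFE v1 /esym/negbFE v2; apply: (same_parity_no11 Hv v1 v2).
Qed.

(* Letters of [pd(v)] at even positions are 0, so a factor occurring at positions
   of both parities vanishes. *)
Lemma occurs_at_both_parities v u i i' x : is_pd v u ->
  occurs_at u i x -> occurs_at u i' x -> odd i != odd i' ->
  forall n, i <= n < i + size x -> u n = false.
Proof.
move=> Hu Hi Hi' ne n hn; case: (boolP (odd n)) => on; last exact: is_pd_even Hu on.
have -> : n = i + (n - i) by lia.
by rewrite -Hi ?Hi'; try lia; apply: (is_pd_even Hu); lia.
Qed.

(** The two copies of [x] start at positions of opposite parity. *)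
Lemma occurs_at_odd_square v u i x : is_pd v u ->
  occurs_at u i x -> occurs_at u (i + size x) x -> odd (size x) ->
  forall n, i <= n < i + 2 * size x -> u n = false.
Proof.
move=> Hu H1 H2 ox n hn; case: (ltnP n (i + size x)) => hx.
  by apply: (occurs_at_both_parities Hu H1 H2); lia.
by apply: (occurs_at_both_parities Hu H2 H1); lia.
Qed.

(** Here [r] is the parity of the position where [x] starts: the indices [j.*2.+1 - r] then fall on
    odd positions of the surrounding word, where [pd] writes the complemented letters of the
    preimage. *)
Definition unpd (r : bool) (x : seq bool) : seq bool :=
  mkseq (fun j => ~~ nth false x (j.*2.+1 - r)) (size x)./2.

Lemma occurs_at_unpd v u i x : is_pd v u -> ~~ odd (size x) ->
  occurs_at u i x -> occurs_at v i./2 (unpd (odd i) x).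
Proof.
move=> Hu ex H j; rewrite size_mkseq => hj; rewrite nth_mkseq // H; last lia.
have [_ E] := Hu (i./2 + j); apply: negb_inj; rewrite negbK -E.
by congr (u _); lia.
Qed.

(** Blocks of even length all start at the same parity, so the single parameter [odd i] serves for
    each of them. *)
Lemma occurs_at_apply_unpd v u g p i : is_pd v u ->
  (forall c, ~~ odd (size (g c))) -> occurs_at u i (apply_mor g p) ->
  occurs_at v i./2 (apply_mor (unpd (odd i) \o g) p).
Proof.
move=> Hu eg; elim: p i => [|c p IH] i // /occurs_at_cat[H1 H2].
apply/occurs_at_cat; split; first exact: occurs_at_unpd.
have := IH _ H2; rewrite oddD (negbTE (eg c)) addbF size_mkseq.
by rewrite halfD (negbTE (eg c)) andbF.
Qed.

Lemma size_apply_unpd r g p : (forall c, ~~ odd (size (g c))) ->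
  size (apply_mor g p) = (size (apply_mor (unpd r \o g) p)).*2.
Proof.
move=> eg; elim: p => //= c p IH.
rewrite /apply_mor /= !size_cat -/(apply_mor _ _) IH doubleD size_mkseq.
by rewrite even_halfK.
Qed.

Definition encounters_size (w : nat -> bool) (p : seq bool) (n : nat) : Prop :=
  exists g i, [/\ nonerasing g, occurs_at w i (apply_mor g p)
                & size (apply_mor g p) = n].

Lemma encounters_size_unpd v u g p i : is_pd v u -> p != [::] ->
  nonerasing g -> (forall c, ~~ odd (size (g c))) -> occurs_at u i (apply_mor g p) ->
  exists2 n, n < size (apply_mor g p) & encounters_size v p n.
Proof.
move=> Hu p0 neg eg H; have pos c : 0 < size (g c) by rewrite lt0n size_eq0.
exists (size (apply_mor (unpd (odd i) \o g) p)).
  have : 0 < size (apply_mor g p).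
    by case: p p0 {H} => // c p _; rewrite /apply_mor /= size_cat ltn_addr.
  by rewrite (size_apply_unpd (odd i) p eg); lia.
exists (unpd (odd i) \o g), i./2; split=> //; last exact: occurs_at_apply_unpd.
by move=> c; rewrite -size_eq0 size_mkseq; have := pos c; have := eg c; lia.
Qed.

Lemma descent_0000 v u n : same_parity v -> is_pd v u ->
  encounters_size u (bits [:: 0; 0; 0; 0]) n ->
  exists2 n', n' < n & encounters_size v (bits [:: 0; 0; 0; 0]) n'.
Proof.
move=> Hv Hu [g [i [neg H <-]]] {n}.
have pos c : 0 < size (g c) by rewrite lt0n size_eq0.
case: (boolP (odd (size (g false)))) => [ox|ex].
  exfalso; move: H; rewrite /apply_mor /= -[0 == 1]/false !occurs_at_cat => -[H1 [H2 [H3 [H4 _]]]].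
  apply: (is_pd_no0000 (i := i) Hv Hu) => k hk; have := pos false => p0.
  case: (ltnP k (i + 2 * size (g false))) => hk'.
    by apply: (occurs_at_odd_square Hu H1 H2 ox); lia.
  by apply: (occurs_at_odd_square Hu H3 H4 ox); lia.
(* The pattern has no letter 1, so [g true], of unknown parity, may be replaced by [g false]. *)
exact: (@encounters_size_unpd v u (fun=> g false) (bits [:: 0; 0; 0; 0]) i).
Qed.

Lemma descent_00010100 v u n : same_parity v -> is_pd v u ->
  encounters_size u (bits [:: 0; 0; 0; 1; 0; 1; 0; 0]) n ->
  exists2 n', n' < n & encounters_size v (bits [:: 0; 0; 0; 1; 0; 1; 0; 0]) n'.
Proof.
move=> Hv Hu [g [i [neg H <-]]] {n}.
have pos c : 0 < size (g c) by rewrite lt0n size_eq0.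
have := pos false; have := pos true => pb pa.
have no4 j := @is_pd_no0000 v u j Hv Hu.
case: (boolP (odd (size (g false)) || odd (size (g true)))) => [odd_ab|even_ab]; last first.
  apply: (encounters_size_unpd Hu _ _ _ H) => // c.
  by move: even_ab; rewrite negb_or => /andP[]; case: c.
exfalso; move: H; rewrite /apply_mor /= -[0 == 1]/false -[1 == 1]/true !occurs_at_cat.
move=> -[X1 [X2 [X3 [Y1 [X4 [Y2 [X5 [X6 _]]]]]]]].
move: pa pb odd_ab X1 X2 X3 Y1 X4 Y2 X5 X6.
set a := size (g false); set b := size (g true) => pa pb odd_ab X1 X2 X3 Y1 X4 Y2 X5 X6.
(* For [a] even and [b] odd, the copies of [g false] on either side of [g true] start at opposite
   parities, so [g false] is all 0 and its square contains 0000. *)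
case: (boolP (odd a)) => oa; last first.
  have Z := occurs_at_both_parities Hu X3 X4; have Z2 := occurs_at_both_parities Hu X2 X4.
  apply: (no4 (i + a)) => n hn; case: (ltnP n (i + a + a)) => hn'.
    by apply: Z2; rewrite -/a; lia.
  by apply: Z; rewrite -/a; lia.
(* For [a] odd the initial cube is all 0; as 0000 is excluded, [a = 1] and a 1 follows at
   [i + 3]. *)
have Z1 := occurs_at_odd_square Hu X1 X2 oa; have Z2 := occurs_at_odd_square Hu X2 X3 oa.
have Z : forall n, i <= n < i + 3 * a -> u n = false.
  move=> n hn; case: (ltnP n (i + 2 * a)) => hn'.
    by apply: Z1; rewrite -/a; lia.
  by apply: Z2; rewrite -/a; lia.
have a1 : a = 1.
  case: (leqP a 1) => [|a1]; first lia.
  by exfalso; apply: (no4 i) => n hn; apply: Z; lia.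
rewrite a1 in Z.
have u3 : u (i + 3).
  apply: contraT => /negbTE u3; exfalso; apply: (no4 i) => n hn.
  by case: (eqVneq n (i + 3)) => [->//|ne]; apply: Z; lia.
(* The two copies of [g true] are [b + 1] apart; for [b] even their parities would differ and the 1
   that begins [g true] would vanish. *)
have ob : odd b.
  apply: contraT => eb; move: u3.
  by rewrite (occurs_at_both_parities Hu Y1 Y2) // -/a -/b; lia.
have ei : ~~ odd i.
  by apply: contraL u3 => oi; rewrite (is_pd_even Hu) //; lia.
have X5' := occurs_at_odd_square Hu X5 X6 oa.
(* The zeros of [u] at the odd positions [i + 1] and [i + 2 * b + 5] come from 1s of [v] at the odd
   distance [b + 2]. *)
have [_ /(canLR negbK) v1] := Hu i./2.
have [_ /(canLR negbK) v2] := Hu (i./2 + b + 2).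
have := Hv i./2 (i./2 + b + 2); rewrite -v1 -v2.
rewrite Z; last lia.
rewrite X5'; last by rewrite -/a; lia.
by move=> /(_ isT isT); lia.
Qed.

Lemma encountersP w p : encounters w p <-> exists n, encounters_size w p n.
Proof.
split=> [[g [neg /factorP[i H]]]|[n [g [i [neg H _]]]]].
  by exists (size (apply_mor g p)), g, i.
by exists g; split=> //; apply/factorP; exists i.
Qed.

Definition shift0 (w : nat -> bool) : nat -> bool :=
  fun n => if n is k.+1 then w k else false.

(** By [0 pd'(c) = pd(c) 0], a leading 0 turns a [pd']-image into a [pd]-image, so one descent
    argument handles both words. *)
Lemma is_pd_shift0 : is_pd word_l (shift0 word_m).
Proof. by case=> [|i]; split=> //=; have [] := word_m_pd' i; have [] := word_m_pd' i.+1. Qed.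

(* Both words embed in the pd-image of the other one, so a shortest occurrence
   of the pattern would yield a shorter one. *)
Lemma period_doubling_avoids p :
  (forall v u n, same_parity v -> is_pd v u -> encounters_size u p n ->
     exists2 n', n' < n & encounters_size v p n') ->
  forall b, ~ encounters (period_doubling b) p.
Proof.
move=> descent b /encountersP[n]; elim/ltn_ind: n b => n IH [] H.
  have [|n' hn' Hn'] := descent _ (shift0 word_m) n (@word_same_parity false) is_pd_shift0.
    by have [g [i [neg Hi sz]]] := H; exists g, i.+1.
  exact: IH hn' _ Hn'.
have [n' hn' Hn'] := descent _ _ _ (@word_same_parity true) word_l_pd H.
exact: IH hn' _ Hn'.
Qed.

Lemma good_period_doubling b : good (period_doubling b).
Proof.
have odd_gap i k : odd k -> period_doubling b i -> period_doubling b (i + k) -> False.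
  by move=> ok wi wk; have := word_same_parity wi wk; rewrite oddD ok addbT; case: odd.
split.
- move=> /factorP[i Hi]; apply: (odd_gap i 1) => //; first by rewrite -[i]addn0 -(Hi 0).
  by rewrite -(Hi 1).
- move=> /factorP[i Hi]; apply: (odd_gap i 3) => //; first by rewrite -[i]addn0 -(Hi 0).
  by rewrite -(Hi 3).
- by apply: period_doubling_avoids; apply: descent_0000.
- by apply: period_doubling_avoids; apply: descent_00010100.
Qed.

(** * Extremality and uniqueness in the lexicographic order *)

Definition agree_below (k : nat) (v w : nat -> bool) : Prop :=
  forall j, j < k -> v j = w j.

(** Quantifying over all common prefixes avoids having to find a first difference. *)
Definition lexle (v w : nat -> bool) : Prop :=
  forall k, agree_below k v w -> v k ==> w k.

Lemma lexle_prefix v w n : lexle v w -> lex_le (prefix_of v n) (prefix_of w n).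
Proof.
elim: n v w => [|n IH] v w H; first exact: lexx.
have le0 : v 0 ==> w 0 by apply: H.
have mkS (f : nat -> bool) : prefix_of f n.+1 = f 0 :: prefix_of (f \o succn) n.
  by rewrite /prefix_of /mkseq /= (iotaDl 1 0) -map_comp.
rewrite !mkS /lex_le lexi_cons; apply/andP; split.
  by case: (v 0) le0; case: (w 0).
apply/implyP => le_wv; apply: IH => k Hk.
have e0 : v 0 = w 0.
  by case: (v 0) le0 le_wv; case: (w 0).
by apply: (H k.+1) => -[|j] //; apply: Hk.
Qed.

Lemma good_extremal k : forall w, good w ->
  (agree_below k w word_m -> w k ==> word_m k) /\
  (agree_below k word_l w -> word_l k ==> w k).
Proof.
elim/ltn_ind: k => k IH w Hw; split=> Hk; apply/implyP.
- case: (posnP k) => [->|k0] // wk.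
  (* The leading 1 puts all 1s of [w] at even positions, and makes the [pd']-preimage start with 0,
     as [good_of_pd'] requires. *)
  have w0 : w 0 by rewrite Hk.
  have Hpd := good_is_pd' Hw (isT : ~~ odd 0) w0.
  have Hgood := good_of_pd' Hpd (negbTE (introT negPn w0)) Hw.
  have ek : ~~ odd k.
    apply: contraL wk => ok; have [_] := Hpd k./2.
    by rewrite (_ : _.*2.+1 = k); [move=> -> | lia].
  have Ek : k./2.*2 = k by lia.
  have lt_k : k./2 < k by lia.
  have [_] := IH _ lt_k _ Hgood.
  have [Em _] := word_m_pd' k./2; rewrite Ek in Em; rewrite Em Ek wk implybF.
  apply=> j hj; have [Ej _] := word_m_pd' j.
  by rewrite Hk; [rewrite Ej negbK | lia].
- case: (posnP k) => [->|k0] // lk.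
  have ok : odd k by rewrite (word_parity lk).
  (* The first 1 of [word_l] is at position 3, so [w] starts with 000; avoiding 0000 then forces a 1
     at the odd position 3. *)
  have k3 : 3 <= k by move: lk ok; case: k {IH Hk} k0 => [|[|[|k]]].
  have w3 : w 3 by apply: (good_no0000 Hw); rewrite -Hk //; lia.
  have Hpd := good_is_pd Hw (isT : odd 3) w3.
  have Hgood := good_of_pd Hpd Hw.
  have Ek : k./2.*2.+1 = k by lia.
  have lt_k : k./2 < k by lia.
  have [+ _] := IH _ lt_k _ Hgood.
  have [_ El] := word_l_pd k./2; rewrite Ek lk in El.
  move/(canLR negbK): El => <- /=; rewrite Ek implybF negbK.
  apply=> j hj; have [_ Ej] := word_l_pd j.
  by rewrite -Hk; [rewrite Ej negbK | lia].
Qed.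

Lemma is_m_word_m : is_m word_m.
Proof.
move=> n; split=> [|_ [w [Hw ->]]].
  by exists word_m; split=> //; apply: good_period_doubling.
by apply: lexle_prefix => k; have [] := good_extremal k Hw.
Qed.

Lemma is_ell_word_l : is_ell word_l.
Proof.
move=> n; split=> [|_ [w [Hw ->]]].
  by exists word_l; split=> //; apply: good_period_doubling.
by apply: lexle_prefix => k; have [] := good_extremal k Hw.
Qed.

Lemma prefix_of_inj v w : (forall n, prefix_of v n = prefix_of w n) -> v =1 w.
Proof.
move=> H i; have := congr1 (fun s => nth false s i) (H i.+1).
by rewrite !nth_mkseq.
Qed.

Lemma is_m_unique m m' : is_m m -> is_m m' -> m =1 m'.
Proof.
move=> Hm Hm'; apply: prefix_of_inj => n.
have [g le] := Hm n; have [g' le'] := Hm' n.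
by apply/(@le_anti _ (seqlexi bool)); rewrite [X in X && _]le' // [X in _ && X]le.
Qed.

Lemma is_ell_unique l l' : is_ell l -> is_ell l' -> l =1 l'.
Proof.
move=> Hl Hl'; apply: prefix_of_inj => n.
have [g le] := Hl n; have [g' le'] := Hl' n.
by apply/(@le_anti _ (seqlexi bool)); rewrite [X in X && _]le // [X in _ && X]le'.
Qed.

(** * Fixed points of uniform morphisms *)

Lemma nth_apply_mor h n : 0 < n -> (forall c, size (h c) = n) ->
  forall u i, i < n * size u ->
  nth false (apply_mor h u) i = nth false (h (nth false u (i %/ n))) (i %% n).
Proof.
move=> n0 sh; elim=> [|c u IH] i /=; first by rewrite muln0.
rewrite mulnS nth_cat sh -/(apply_mor h u) => hlt; case: (ltnP i n) => hi.
  by rewrite divn_small ?modn_small.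
have [j def_i] : exists j, i = n + j by exists (i - n); lia.
by subst i; rewrite addKn divnDl ?divnn ?n0 ?dvdnn //= modnDl IH //; lia.
Qed.

Lemma apply_mor_infE h n w i : 0 < n -> (forall c, size (h c) = n) ->
  apply_mor_inf h w i = nth false (h (w (i %/ n))) (i %% n).
Proof.
move=> n0 sh; rewrite /apply_mor_inf (nth_apply_mor n0) ?size_mkseq //; last first.
  by rewrite mulnS; nia.
by rewrite nth_mkseq // ltnS leq_div.
Qed.

(** Letter [i] is determined by letter [i %/ n], which is earlier unless [i = 0]; the common first
    letter [c0] settles that case. *)
Lemma fixed_point_unique h n c0 w w' : 1 < n -> (forall c, size (h c) = n) ->
  (forall c, nth false (h c) 0 = c0) ->
  fixed_point h w -> fixed_point h w' -> w' =1 w.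
Proof.
move=> n1 sh h0 Hw Hw' i; have n0 := ltnW n1.
elim/ltn_ind: i => i IH; rewrite Hw Hw' !(apply_mor_infE _ _ n0 sh).
case: (posnP i) => [->|i0]; first by rewrite mod0n !h0.
by rewrite IH // ltn_Pdiv.
Qed.

Lemma the_fixed_point_ext h n c0 w w' : 1 < n -> (forall c, size (h c) = n) ->
  (forall c, nth false (h c) 0 = c0) ->
  fixed_point h w -> w' =1 w -> the_fixed_point h w'.
Proof.
move=> n1 sh h0 Hw E; have n0 := ltnW n1.
have Hw' : fixed_point h w'.
  by move=> i; rewrite !(apply_mor_infE _ _ n0 sh) !E Hw (apply_mor_infE _ _ n0 sh).
by split=> // w'' Hw''; apply: (fixed_point_unique n1 sh h0 Hw' Hw'').
Qed.

Lemma fixed_point_word_m : fixed_point h1 word_m.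
Proof.
move=> i; rewrite (@apply_mor_infE _ 4) //; last by case.
rewrite {1}(divn_eq i 4); have := ltn_pmod i (isT : 0 < 4).
move: (i %/ 4) (i %% 4) => q r.
(* Letter [q] of [word_m] yields letters [2q] and [2q + 1] of [word_l], and these yield the four
   letters of [word_m] from [4q] on. *)
have [m0 m1] := word_m_pd' q.*2; have [m2 m3] := word_m_pd' q.*2.+1.
have [l0 l1] := word_l_pd q.
have -> : q * 4 = q.*2.*2 by lia.
by case: r => [|[|[|[|r]]]] // _;
  rewrite ?addn0 ?addn1 ?addn2 ?addn3 ?m0 ?m1 ?m2 ?m3 ?l0 ?l1;
  case: (word_m q).
Qed.

Lemma fixed_point_word_l : fixed_point h2 word_l.
Proof.
move=> i; rewrite (@apply_mor_infE _ 4) //; last by case.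
rewrite {1}(divn_eq i 4); have := ltn_pmod i (isT : 0 < 4).
move: (i %/ 4) (i %% 4) => q r.
have [l0 l1] := word_l_pd q.*2; have [l2 l3] := word_l_pd q.*2.+1.
have [m0 m1] := word_m_pd' q.
have -> : q * 4 = q.*2.*2 by lia.
by case: r => [|[|[|[|r]]]] // _;
  rewrite ?addn0 ?addn1 ?addn2 ?addn3 ?l0 ?l1 ?l2 ?l3 ?m0 ?m1;
  case: (word_l q).
Qed.

Theorem theorem4p5 :
  ((exists m : nat -> bool, is_m m) /\
   (forall m : nat -> bool, is_m m -> the_fixed_point h1 m)) /\
  ((exists l : nat -> bool, is_ell l) /\
   (forall l : nat -> bool, is_ell l -> the_fixed_point h2 l)).
Proof.
split; split.
- by exists word_m; apply: is_m_word_m.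
- move=> m Hm; apply: (@the_fixed_point_ext h1 4 true word_m) => //; try by case.
    exact: fixed_point_word_m.
  exact: is_m_unique Hm is_m_word_m.
- by exists word_l; apply: is_ell_word_l.
- move=> l Hl; apply: (@the_fixed_point_ext h2 4 false word_l) => //; try by case.
    exact: fixed_point_word_l.
  exact: is_ell_unique Hl is_ell_word_l.
Qed.
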